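(* Let $G_\Gamma$ be the right-angled Artin group associated to the graph $\Gamma=(\mathsf{V},\mathsf{E})$. Then $$\mathcal{V}_1(G_\Gamma)=\bigcup_{\mathsf{W}}\mathbb{T}_{\mathsf{W}},$$ where the union is over all subsets $\mathsf{W}\subset\mathsf{V}$ such that $\Gamma(\mathsf{W})$ is maximally disconnected. Moreover, this decomposition coincides with the decomposition into irreducible components of $\mathcal{V}_1(G_\Gamma)$.
   Context: $\Gamma=(\mathsf{V},\mathsf{E})$ is a finite simplicial graph with vertex set $\mathsf{V}$ and edge set $\mathsf{E}\subset\binom{\mathsf{V}}{2}$. The right-angled Artin group $G_\Gamma$ is the group generated by the vertices $v\in\mathsf{V}$, with a defining relation $vw=wv$ for each edge $\{v,w\}\in\mathsf{E}$. For a subset $\mathsf{W}\subset\mathsf{V}$, $\Gamma(\mathsf{W})$ denotes the full subgraph of $\Gamma$ with vertex set $\mathsf{W}$ and edge set $\mathsf{E}\cap\binom{\mathsf{W}}{2}$. ''Maximally disconnected'' means that $\Gamma(\mathsf{W})$ is disconnected, and $\mathsf{W}$ is maximal with respect to this property. For a finitely generated group $G$, the first characteristic variety is $\mathcal{V}_1(G)=\{\rho\in\mathrm{Hom}(G,\mathbb{C}^* )\mid \dim_{\mathbb{C}}H^1(G,{}_\rho\mathbb{C})\ge 1\}$, where ${}_\rho\mathbb{C}$ is the $G$-module $\mathbb{C}$ with action given by $\rho$. The character torus $\mathbb{T}_{G_\Gamma}=\mathrm{Hom}(G_\Gamma,\mathbb{C}^* )$ is identified with $(\mathbb{C}^* )^{\mathsf{V}}$,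 and, for $\mathsf{W}\subset\mathsf{V}$, the subtorus $\mathbb{T}_{\mathsf{W}}\subset\mathbb{T}_{G_\Gamma}$ is defined by $\mathbb{T}_{\mathsf{W}}=\{(t_v)_{v\in\mathsf{V}}\in(\mathbb{C}^* )^{\mathsf{V}}\mid t_v=1\text{ for }v\notin\mathsf{W}\}$. *)

(* Defs.v *)
From HB Require Import structures.
(* mpoly redefines `symmetric`, hence its position. *)
From mathcomp Require Import mpoly.
From mathcomp Require Import all_boot all_order all_algebra.
From mathcomp Require Import boolp classical_sets reals complex.

Set Implicit Arguments.
Unset Strict Implicit.
Unset Printing Implicit Defensive.

Import GRing.Theory.

Local Open Scope ring_scope.
Local Open Scope classical_set_scope.

Section PresentedGroup.
Variables (X : choiceType).

(* The letter (x, true) stands for x and (x, false) for the inverse of x. *)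
Definition word := seq (X * bool).

Variable rel : word -> word -> Prop.

Inductive word_eq : word -> word -> Prop :=
| word_eq_refl u : word_eq u u
| word_eq_sym u v : word_eq u v -> word_eq v u
| word_eq_trans u v w : word_eq u v -> word_eq v w -> word_eq u w
| word_eq_cat u u' v v' :
    word_eq u u' -> word_eq v v' -> word_eq (u ++ v) (u' ++ v')
| word_eq_cancel x b : word_eq [:: (x, b); (x, ~~ b)] [::]
| word_eq_rel u v : rel u v -> word_eq u v.

Definition word_eqb (u v : word) : bool := `[< word_eq u v >].

Lemma word_eqb_refl : reflexive word_eqb.
Proof. by move=> u; apply/asboolP; exact: word_eq_refl. Qed.

Lemma word_eqb_sym : symmetric word_eqb.
Proof. by move=> u v; apply/asboolP/asboolP; exact: word_eq_sym. Qed.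

Lemma word_eqb_trans : transitive word_eqb.
Proof.
move=> v u w /asboolP uv /asboolP vw; apply/asboolP.
exact: word_eq_trans uv vw.
Qed.

Canonical word_equiv :=
  EquivRel word_eqb word_eqb_refl word_eqb_sym word_eqb_trans.

Definition presented_group := {eq_quot word_equiv}%qT.

HB.instance Definition _ := Choice.on presented_group.

Definition pres_class (u : word) : presented_group := (\pi u)%qT.
Definition pres_repr (g : presented_group) : word := repr g.

Lemma pres_reprK g : pres_class (pres_repr g) = g.
Proof. exact: reprK. Qed.

Lemma pres_class_eq u v : pres_class u = pres_class v <-> word_eq u v.
Proof.
split=> [/eqquotP /asboolP //|uv].
by apply/eqquotP/asboolP.
Qed.

Lemma pres_repr_class u : word_eq (pres_repr (pres_class u)) u.
Proof. by apply/pres_class_eq; rewrite pres_reprK. Qed.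

Definition inv_word (u : word) : word := rev [seq (l.1, ~~ l.2) | l <- u].

Definition pres_mul (g h : presented_group) :=
  pres_class (pres_repr g ++ pres_repr h).
Definition pres_one : presented_group := pres_class [::].
Definition pres_inv (g : presented_group) :=
  pres_class (inv_word (pres_repr g)).

Lemma pres_classM u v :
  pres_mul (pres_class u) (pres_class v) = pres_class (u ++ v).
Proof. by apply/pres_class_eq; apply: word_eq_cat; exact: pres_repr_class. Qed.

Lemma pres_mulA : associative pres_mul.
Proof.
move=> f g h.
by rewrite -[f]pres_reprK -[g]pres_reprK -[h]pres_reprK !pres_classM catA.
Qed.

Lemma pres_mul1 : left_id pres_one pres_mul.
Proof. by move=> g; rewrite -[g]pres_reprK pres_classM. Qed.

Lemma pres_mulr1 : right_id pres_one pres_mul.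
Proof. by move=> g; rewrite -[g]pres_reprK pres_classM cats0. Qed.

Lemma word_eq_mulV u : word_eq (u ++ inv_word u) [::].
Proof.
elim: u => [|[x b] u IHu]; first exact: word_eq_refl.
have -> : ((x, b) :: u) ++ inv_word ((x, b) :: u)
    = ([:: (x, b)] ++ (u ++ inv_word u)) ++ [:: (x, ~~ b)].
  by rewrite /inv_word /= rev_cons -cats1 catA.
apply: word_eq_trans (word_eq_cancel x b).
apply: (@word_eq_cat _ [:: (x, b)]); last exact: word_eq_refl.
exact: (word_eq_cat (word_eq_refl [:: (x, b)]) IHu).
Qed.

Lemma inv_wordK : involutive inv_word.
Proof.
move=> u; rewrite /inv_word map_rev revK -map_comp -[RHS]map_id.
by apply: eq_map => -[x b] /=; rewrite negbK.
Qed.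

Lemma pres_mulgV : right_inverse pres_one pres_inv pres_mul.
Proof.
move=> g; rewrite -{1}[g]pres_reprK pres_classM.
by apply/pres_class_eq; exact: word_eq_mulV.
Qed.

Lemma pres_mulVg : left_inverse pres_one pres_inv pres_mul.
Proof.
move=> g; rewrite -{2}[g]pres_reprK pres_classM.
apply/pres_class_eq; rewrite -{2}[pres_repr g]inv_wordK.
exact: word_eq_mulV.
Qed.

HB.instance Definition _ := isGroup.Build presented_group
  pres_mulA pres_mul1 pres_mulr1 pres_mulVg pres_mulgV.

Definition pres_gen (x : X) : presented_group := pres_class [:: (x, true)].

End PresentedGroup.

(* A finite simplicial graph is a symmetric irreflexive relation on a finite
   type. *)

Section RightAngledArtinGroup.
Variables (V : finType) (e : rel V).

Definition commutation (u u' : word V) : Prop :=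
  exists v w : V, [/\ e v w, u = [:: (v, true); (w, true)]
                           & u' = [:: (w, true); (v, true)]].

Definition raag := presented_group commutation.

HB.instance Definition _ := Group.on raag.

Definition raag_gen (v : V) : raag := pres_gen commutation v.

Definition induced_edge (W : {set V}) : rel V :=
  [rel x y | [&& x \in W, y \in W & e x y]].

(* Connected means having exactly one connected component. In particular the
   full subgraph on the empty set is not connected, so that the empty set is
   maximally disconnected when the graph is complete; this is what the equality
   V_1(Z^n) = {1}, n > 0, requires. *)
Definition connected_on (W : {set V}) : bool :=
  [exists x, x \in W] &&
  [forall x in W, forall y in W, connect (induced_edge W) x y].

Definition disconnected_on (W : {set V}) : bool := ~~ connected_on W.

Definition max_disconnected (W : {set V}) : bool := maxset disconnected_on W.

End RightAngledArtinGroup.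

Section MulGroup.
Variable F : fieldType.

Record mul_group := MulGroup { mul_val : F ; mul_valP : mul_val != 0 }.

HB.instance Definition _ := [isSub for mul_val].
HB.instance Definition _ := [Choice of mul_group by <:].

Definition mulg_mul (x y : mul_group) : mul_group :=
  MulGroup (mulf_neq0 (mul_valP x) (mul_valP y)).
Definition mulg_one : mul_group := MulGroup (oner_neq0 F).
Definition mulg_inv (x : mul_group) : mul_group :=
  MulGroup (invr_neq0 (mul_valP x)).

Lemma mulg_mulA : associative mulg_mul.
Proof. by move=> x y z; apply: val_inj; exact: mulrA. Qed.

Lemma mulg_mul1 : left_id mulg_one mulg_mul.
Proof. by move=> x; apply: val_inj; exact: mul1r. Qed.

Lemma mulg_mulr1 : right_id mulg_one mulg_mul.
Proof. by move=> x; apply: val_inj; exact: mulr1. Qed.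

Lemma mulg_mulVg : left_inverse mulg_one mulg_inv mulg_mul.
Proof. by move=> x; apply: val_inj; apply: mulVf (mul_valP x). Qed.

Lemma mulg_mulgV : right_inverse mulg_one mulg_inv mulg_mul.
Proof. by move=> x; apply: val_inj; apply: divff (mul_valP x). Qed.

HB.instance Definition _ := isGroup.Build mul_group
  mulg_mulA mulg_mul1 mulg_mulr1 mulg_mulVg mulg_mulgV.

End MulGroup.

Section CharacteristicVariety.
Variables (F : fieldType) (G : groupType).

Definition character := {multiplicative G -> mul_group F}.

(* The inhomogeneous cochain complex of G with coefficients in F, on which
   g acts as multiplication by rho g, in degrees 0, 1 and 2. *)
Definition coboundary0 (rho : character) (c : F) : G -> F :=
  fun g => mul_val (rho g) * c - c.

Definition coboundary1 (rho : character) (f : G -> F) : G -> G -> F :=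
  fun g h => mul_val (rho g) * f h - f (g * h)%g + f g.

Definition cocycles1 (rho : character) : set (G -> F) :=
  [set f | forall g h, coboundary1 rho f g h = 0].

Definition coboundaries1 (rho : character) : set (G -> F) :=
  range (coboundary0 rho).

(* dim H^1(G, F_rho) >= k : some k cocycles have linearly independent classes
   in the quotient of the cocycles by the coboundaries. *)
Definition dim_H1_ge (rho : character) (k : nat) : Prop :=
  exists f : 'I_k -> G -> F,
    (forall i, cocycles1 rho (f i)) /\
    (forall a : 'I_k -> F,
       coboundaries1 rho (fun g => \sum_(i < k) a i * f i g) ->
       forall i, a i = 0).

Definition char_variety1 : set character := [set rho | dim_H1_ge rho 1].

End CharacteristicVariety.

Arguments char_variety1 : clear implicits.

Section Torus.
Variables (F : fieldType) (V : finType).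

Definition torus := {ffun V -> mul_group F}.

Definition subtorus (W : {set V}) : set torus :=
  [set t : torus | forall v, v \notin W -> t v = 1%g].

Definition zero_locus (S : set {mpoly F[#|V|]}) : set torus :=
  [set t : torus | forall p, S p -> p.@[fun i => mul_val (t (enum_val i))] = 0].

(* Polynomials and Laurent polynomials have the same zero loci in the torus. *)
Definition zariski_closed (Z : set torus) : Prop :=
  exists S, Z = zero_locus S.

Definition zariski_irreducible (Z : set torus) : Prop :=
  Z !=set0 /\
  forall A B : set torus, zariski_closed A -> zariski_closed B ->
    Z `<=` A `|` B -> Z `<=` A \/ Z `<=` B.

Definition irreducible_component (X Z : set torus) : Prop :=
  [/\ Z `<=` X, zariski_irreducible Z
    & forall Y, Y `<=` X -> zariski_irreducible Y -> Z `<=` Y -> Y = Z].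

End Torus.

Arguments subtorus : clear implicits.

Section CharacterTorus.
Variables (F : fieldType) (V : finType) (e : rel V).

(* The identification of Hom(G_Gamma, F^* ) with (F^* )^V; it is bijective by
   char_coords_bij below. *)
Definition char_coords (rho : character F (raag e)) : torus F V :=
  [ffun v => rho (raag_gen e v)].

Definition word_value (t : torus F V) (u : word V) : mul_group F :=
  (\prod_(l <- u) (if l.2 then t l.1 else (t l.1)^-1))%g.

Lemma word_value_eq t u v :
  word_eq (commutation e) u v -> word_value t u = word_value t v.
Proof.
elim=> {u v} //.
- by move=> u v w _ -> _ ->.
- by move=> u u' v v' _ Hu _ Hv; rewrite /word_value !big_cat /= -/(word_value t u)
    -/(word_value t v) Hu Hv.
- move=> x b; rewrite /word_value !big_cons !big_nil mulg1.
  by case: b => /=; rewrite ?mulgV ?mulVg.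
- move=> _ _ [v [w [_ -> ->]]]; rewrite /word_value !big_cons !big_nil /= !mulg1.
  by apply: val_inj; exact: mulrC.
Qed.

Section CharOf.
Variable t : torus F V.

Definition char_fun (g : raag e) : mul_group F := word_value t (pres_repr g).

Lemma char_funM : {morph char_fun : g h / (g * h)%g}.
Proof.
move=> g h; rewrite /char_fun (word_value_eq t (pres_repr_class _ _)).
by rewrite /word_value big_cat.
Qed.

HB.instance Definition _ := isMultiplicative.Build _ _ char_fun char_funM.

Definition char_of : character F (raag e) := char_fun.
End CharOf.

Lemma character_eqP (rho sigma : character F (raag e)) :
  (rho : _ -> _) =1 sigma -> rho = sigma.
Proof.
case: rho => f [[fM]]; case: sigma => g [[gM]] /= /funext fg.
by rewrite -{}fg in gM *; rewrite (Prop_irrelevance fM gM).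
Qed.

Lemma char_of_coords : cancel char_coords char_of.
Proof.
move=> rho; apply: character_eqP => g /=.
have rho1 : rho 1%g = 1%g.
  by apply: (mulgI (rho 1%g)); rewrite -gmulfM !mulg1.
rewrite -[in RHS](pres_reprK g) /char_of /= /char_fun /word_value.
elim: (pres_repr g) => [|[v b] u IHu]; first by rewrite big_nil -rho1.
rewrite big_cons -cat1s -pres_classM IHu.
have -> (x y : raag e) : rho (pres_mul x y) = (rho x * rho y)%g.
  exact: gmulfM.
congr (_ * _)%g; rewrite ffunE /=; case: b => //.
apply: (mulgI (rho (raag_gen e v))); rewrite mulgV -gmulfM -rho1.
congr (rho _); symmetry; apply: etrans (pres_classM _ _ _) _.
by apply/pres_class_eq; exact: word_eq_cancel.
Qed.

Lemma coords_char_of : cancel char_of char_coords.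
Proof.
move=> t; apply/ffunP => v; rewrite ffunE /char_of /= /char_fun.
rewrite (word_value_eq t (pres_repr_class _ _)).
by rewrite /word_value big_cons big_nil /= mulg1.
Qed.

Lemma char_coords_bij : bijective char_coords.
Proof. by exists char_of; [exact: char_of_coords|exact: coords_char_of]. Qed.

Definition raag_char_variety1 : set (torus F V) :=
  char_coords @` char_variety1 F (raag e).

End CharacterTorus.

Arguments raag_char_variety1 F {V} e.

(* Main.v *)
Require Import Defs.
From HB Require Import structures.
From mathcomp Require Import mpoly.
From mathcomp Require Import all_boot all_order all_algebra.
From mathcomp Require Import boolp classical_sets reals complex.
From mathcomp Require Import ring.

Set Implicit Arguments.
Unset Strict Implicit.
Unset Printing Implicit Defensive.

Import GRing.Theory.

Local Open Scope ring_scope.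
Local Open Scope classical_set_scope.

(** A 1-cocycle on [G_Gamma] with coefficients twisted by a character [t] is
    determined by its values [x v] on the generators, and the only constraint
    on these comes from the commutation relations: evaluating the cocycle on
    [vw = wv] gives [(t v - 1) x w = (t w - 1) x v] for each edge.  The
    coboundaries are the multiples of [v |-> t v - 1].  So [t] lies in [V_1]
    exactly when these linear equations have a solution that is not such a
    multiple ([raag_char_variety1P]).

    Let [S] be the set of vertices with [t v <> 1].  The equations say that
    [x v / (t v - 1)] is constant along the edges inside [S], and that [x]
    vanishes at each vertex outside [S] with a neighbour in [S].  A solution
    beyond the coboundaries thus comes from a second component of [S], or from
    a vertex neither in [S] nor adjacent to it; in both cases [S] lies in a
    vertex set [W] whose full subgraph is disconnected, and the converse holds
    as well (for [S] empty, [W] can be empty, which counts as disconnected; see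
    [char_variety_disconnected], [disconnected_char_variety]).  Enlarging [W]
    to a maximal such set gives the union of subtori.

    For the components, each subtorus is Zariski closed, and it is irreducible
    because two of its points are joined by a line: two polynomials that each
    fail to vanish at some point of the subtorus restrict to nonzero
    polynomials in one variable along that line, and an infinite field has a
    point where neither of them, nor any coordinate, vanishes
    ([subtorus_irreducible]).  A finite union of closed irreducible sets with
    no inclusions among them has these sets as its components, and inclusions
    of subtori are inclusions of vertex sets. *)

(** * Cocycles of a group with values in a rank one module *)

Section Cocycles.
Variables (F : fieldType) (G : groupType) (rho : character F G).

(** In a quotient vector space, a family of one vector is free exactly when
    the vector is nonzero; this removes the linear combinations from the
    definition of [V_1]. *)
Lemma char_variety1P :
  char_variety1 F G rho <->
  exists2 f, cocycles1 rho f & ~ coboundaries1 rho f.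
Proof.
split=> [[f [fZ f_free]]|[f fZ fB]].
  exists (f ord0) => // -[c _ fc].
  suff /f_free/(_ ord0)/eqP :
      coboundaries1 rho (fun g => \sum_(i < 1) (fun=> 1) i * f i g).
    by rewrite oner_eq0.
  exists c => //; rewrite fc; apply/funext => g.
  by rewrite big_ord1 mul1r.
exists (fun=> f); split=> // a [c _ fc] i; rewrite ord1.
apply: contra_notP fB => /eqP a0.
exists ((a ord0)^-1 * c) => //; apply/funext => g.
have := congr1 (fun h => (a ord0)^-1 * h g) fc.
by rewrite /coboundary0 big_ord1 mulKf // => <-; ring.
Qed.

Lemma cocycleM f g h : cocycles1 rho f ->
  f (g * h)%g = f g + mul_val (rho g) * f h.
Proof.
by move=> /(_ g h)/eqP; rewrite /coboundary1 addrAC subr_eq0 addrC => /eqP.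
Qed.

Lemma char1 : rho 1%g = 1%g.
Proof. by apply: (mulgI (rho 1%g)); rewrite -gmulfM !mulg1. Qed.

Lemma cocycle1 f : cocycles1 rho f -> f 1%g = 0.
Proof.
move=> /(cocycleM 1%g 1%g); rewrite mulg1 char1 mul1r => /eqP.
by rewrite -subr_eq subrr eq_sym => /eqP.
Qed.

Lemma coboundary_cocycle c : cocycles1 rho (coboundary0 rho c).
Proof.
move=> g h; rewrite /coboundary1 /coboundary0 gmulfM /=; ring.
Qed.

End Cocycles.

(** * Cocycles of a right-angled Artin group *)

Section RaagCocycles.
Variables (F : fieldType) (V : finType) (e : rel V).
Implicit Types (t : torus F V) (x : V -> F).

Definition letter_value t (l : V * bool) : mul_group F :=
  if l.2 then t l.1 else (t l.1)^-1%g.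

(** The value on an inverse letter is forced by [f (g * g^-1) = 0]. *)
Definition letter_cocycle t x (l : V * bool) : F :=
  if l.2 then x l.1 else - ((mul_val (t l.1))^-1 * x l.1).

(** The extension of [x] by the rule [f (g * h) = f g + t g * f h], that is,
    the linear combination of the [x v] by the Fox derivatives of the word,
    evaluated at [t]. *)
Definition word_cocycle t x (u : word V) : F :=
  foldr (fun l c => letter_cocycle t x l + mul_val (letter_value t l) * c) 0 u.

Definition edge_cocycle t x : Prop :=
  forall v w, e v w ->
    (mul_val (t v) - 1) * x w = (mul_val (t w) - 1) * x v.

Definition vertex_coboundary t x : Prop :=
  exists c, forall v, x v = (mul_val (t v) - 1) * c.

Lemma word_value_cons t l u :
  mul_val (word_value t (l :: u))
    = mul_val (letter_value t l) * mul_val (word_value t u).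
Proof. by rewrite /word_value big_cons. Qed.

Lemma word_cocycle_cat t x u v :
  word_cocycle t x (u ++ v)
    = word_cocycle t x u + mul_val (word_value t u) * word_cocycle t x v.
Proof.
elim: u => [|l u IHu]; first by rewrite /word_value big_nil add0r mul1r.
by rewrite word_value_cons /= -/(word_cocycle t x _) IHu /=; ring.
Qed.

(** The edge equations are what the commutation relations ask of a cocycle, so
    that they let the extension to words descend to the group. *)
Lemma word_cocycle_eq t x u v : edge_cocycle t x ->
  word_eq (commutation e) u v -> word_cocycle t x u = word_cocycle t x v.
Proof.
move=> tx; elim=> {u v} //.
- by move=> u v w _ -> _ ->.
- move=> u u' v v' uu' Hu _ Hv.
  by rewrite !word_cocycle_cat Hu Hv (word_value_eq t uu').
- move=> v b; have t0 := mul_valP (t v).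
  by case: b => /=; rewrite /letter_cocycle /letter_value /=; field.
- move=> _ _ [v [w [/tx vw -> ->]]] /=.
  rewrite /letter_cocycle /letter_value /= !mulr0 !addr0.
  apply/eqP; rewrite -subr_eq0; apply/eqP.
  transitivity ((mul_val (t v) - 1) * x w - (mul_val (t w) - 1) * x v).
    by ring.
  by rewrite vw subrr.
Qed.

Lemma raag_genV (v : V) :
  pres_class (commutation e) [:: (v, false)] = (raag_gen e v)^-1%g.
Proof.
apply: (mulgI (raag_gen e v)); rewrite mulgV.
apply: etrans (pres_classM _ _ _) _.
by apply/pres_class_eq; exact: word_eq_cancel.
Qed.

(** A cocycle is determined by its values on the generators.  This is what
    turns an equality with a coboundary on the vertices into one on the whole
    group. *)
Lemma cocycle_on_words (rho : character F (raag e)) f u :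
  cocycles1 rho f ->
  f (pres_class (commutation e) u)
    = word_cocycle (char_coords rho) (f \o raag_gen e) u.
Proof.
move=> fZ; elim: u => [|[v b] u IHu] /=; first exact: cocycle1 fZ.
rewrite -cat1s -pres_classM.
rewrite [X in f X](_ : _ = (pres_class (commutation e) [:: (v, b)] : raag e)
                         * (pres_class (commutation e) u : raag e))%g //.
rewrite (cocycleM _ _ fZ) IHu /letter_cocycle /letter_value /= ffunE.
case: b => //; rewrite raag_genV.
have rhoV : rho (raag_gen e v)^-1%g = (rho (raag_gen e v))^-1%g.
  by apply: (mulgI (rho (raag_gen e v))); rewrite -gmulfM !mulgV char1.
rewrite rhoV; congr (_ + _).
have := cocycleM (raag_gen e v)^-1%g (raag_gen e v) fZ.
rewrite mulVg (cocycle1 fZ) rhoV => /esym/eqP.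
by rewrite addr_eq0 => /eqP.
Qed.

(** The twisted cohomology of the group in degree one is that of the
    presentation complex: cochains on the vertices, one equation per edge. *)
Lemma raag_char_variety1P t :
  raag_char_variety1 F e t <->
  exists2 x, edge_cocycle t x & ~ vertex_coboundary t x.
Proof.
split=> [[rho /char_variety1P[f fZ fB] <-]|[x tx xB]].
  exists (f \o raag_gen e) => [v w vw /=|[c fc]].
    have vwC : (raag_gen e v * raag_gen e w
                = raag_gen e w * raag_gen e v)%g.
      rewrite /raag_gen /pres_gen; apply: etrans (pres_classM _ _ _) _.
      apply: etrans (esym (pres_classM _ _ _)).
      by apply/pres_class_eq/word_eq_rel; exists v, w.
    have := congr1 f vwC; rewrite !(cocycleM _ _ fZ) !ffunE /=.
    set a := mul_val _; set b := mul_val _ => fvw.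
    apply/eqP; rewrite -subr_eq0; apply/eqP.
    transitivity (f (raag_gen e v) + a * f (raag_gen e w)
                  - (f (raag_gen e w) + b * f (raag_gen e v))); first by ring.
    by rewrite fvw subrr.
  apply: fB; exists c => //; apply/funext => g; rewrite -(pres_reprK g).
  rewrite (cocycle_on_words _ fZ).
  rewrite (cocycle_on_words _ (coboundary_cocycle rho c)).
  congr (word_cocycle _ _ _); apply/funext => v /=.
  by have /= -> := fc v; rewrite ffunE /coboundary0; ring.
exists (char_of e t); last exact: coords_char_of.
apply/char_variety1P.
exists (fun g : raag e => word_cocycle t x (pres_repr g)).
  move=> g h; rewrite /coboundary1 (word_cocycle_eq tx (pres_repr_class _ _)).
  rewrite word_cocycle_cat /char_of /= /char_fun; ring.
move=> [c _ xc]; apply: xB; exists c => v.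
have := congr1 (fun f => f (raag_gen e v)) xc.
rewrite (word_cocycle_eq tx (pres_repr_class _ _)) /coboundary0 /=.
rewrite /char_fun (word_value_eq t (pres_repr_class _ _)).
rewrite /word_value big_cons big_nil mulg1.
by rewrite /letter_cocycle /= mulr0 addr0 => <-; ring.
Qed.

End RaagCocycles.

(** * Disconnected full subgraphs *)

Section Disconnected.
Variables (V : finType) (e : rel V).
Hypothesis e_sym : symmetric e.

Definition separates (W A : {set V}) : Prop :=
  [/\ A \subset W, A != finset.set0, W :\: A != finset.set0
    & {in A & W :\: A, forall v w, ~~ e v w}].

Lemma separates_disconnected W A : separates W A -> disconnected_on e W.
Proof.
case=> AW /set0Pn[a Aa] /set0Pn[b WAb] AB.
have Wb : b \in W by move: WAb; rewrite inE => /andP[].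
rewrite /disconnected_on /connected_on negb_and; apply/orP; right.
apply/forall_inPn; exists a; first exact: (fintype.subsetP AW).
apply/forall_inPn; exists b => //.
apply/negP => ab.
have Acl : closed (induced_edge e W) (mem A).
  move=> v w /and3P[Wv Ww vw]; apply/idP/idP => /= Av; apply/negPn/negP => Aw.
    by have := AB v w Av; rewrite inE Aw Ww vw => /(_ isT).
  by have := AB w v Av; rewrite inE Aw Wv e_sym vw => /(_ isT).
have := closed_connect Acl ab; rewrite /= Aa => Ab.
by move: WAb; rewrite inE -Ab.
Qed.

(** The connected component of a vertex that does not reach all of [W]
    separates [W].  The empty set is disconnected but has no separation. *)
Lemma disconnected_separates W : disconnected_on e W -> W != finset.set0 ->
  exists A, separates W A.
Proof.
move=> + /set0Pn[w0 Ww0]; rewrite /disconnected_on negb_and.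
case/orP=> [/existsPn/(_ w0)|]; first by rewrite Ww0.
case/forall_inPn=> a Wa /forall_inPn[b Wb ab].
exists [set v in W | connect (induced_edge e W) a v]%SET; split.
- by apply/fintype.subsetP => v; rewrite inE => /andP[].
- by apply/set0Pn; exists a; rewrite inE Wa connect0.
- by apply/set0Pn; exists b; rewrite !inE Wb (negPf ab).
- move=> v w; rewrite !inE => /andP[Wv av] /andP[+ Ww]; rewrite Ww /=.
  apply: contra => vw; apply: connect_trans av _.
  exact/connect1/and3P.
Qed.

Lemma disconnected_on0 : disconnected_on e finset.set0.
Proof.
rewrite /disconnected_on negb_and; apply/orP; left.
by apply/existsPn => v; rewrite inE.
Qed.

End Disconnected.

(** * The characteristic variety as a union of subtori *)

Section CharVariety.
Variables (F : fieldType) (V : finType) (e : rel V).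
Hypotheses (V_nonempty : (0 < #|V|)%N) (e_sym : symmetric e).
Implicit Types (t : torus F V) (W : {set V}).

Lemma nontrivial_coord t v : t v != 1%g -> mul_val (t v) - 1 != 0.
Proof. by rewrite subr_eq0. Qed.

(** When [b] lies outside the support of [t] and has no neighbour in it, every
    edge equation at [b] is trivial.  So the indicator of [b] is a solution,
    while coboundaries vanish at [b]. *)
Lemma isolated_vertex_char_variety t b : t b = 1%g ->
  (forall v, e v b -> t v = 1%g) -> raag_char_variety1 F e t.
Proof.
move=> tb1 tb; apply/raag_char_variety1P; exists (fun v => (v == b)%:R).
  move=> v w vw; have [wb|wb] := eqVneq w b; have [vb|vb] := eqVneq v b.
  - by rewrite wb vb.
  - by rewrite tb ?tb1 -?wb //= subrr mulr0 mul0r.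
  - by rewrite (tb w) ?tb1 ?vb -?vb 1?e_sym //= ?vb ?tb1 subrr mulr0 mul0r.
  - by rewrite !mulr0.
by move=> [c /(_ b)/eqP]; rewrite eqxx tb1 subrr mul0r oner_eq0.
Qed.

(** Split [W] into parts without edges between them.  If the support of [t]
    misses one part, a vertex of that part is isolated from the support.
    Otherwise cutting the coboundary [t - 1] down to one part keeps the edge
    equations, and the result is proportional to [t - 1] with factor 1 on one
    part and 0 on the other.  If [W] is empty then [t] is trivial, and any
    vertex will do. *)
Lemma disconnected_char_variety t W :
  disconnected_on e W -> subtorus F V W t -> raag_char_variety1 F e t.
Proof.
move=> Wd tW; have [W0|Wn0] := eqVneq W finset.set0.
  have t1 v : t v = 1%g by apply: tW; rewrite W0 inE.
  have /card_gt0P[v _] := V_nonempty.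
  exact: (isolated_vertex_char_variety (b := v)).
have [A [AW /set0Pn[a Aa] /set0Pn[b WAb] AB]] := disconnected_separates Wd Wn0.
case: (boolP [forall v in A, t v == 1%g]) => [/forall_inP tA|].
  apply: (isolated_vertex_char_variety (b := a)) => [|v va]; first exact/eqP/tA.
  apply/eqP; have [/tA //|Av] := boolP (v \in A).
  have [Wv|/tW ->//] := boolP (v \in W).
  by have := AB a v Aa; rewrite inE Av Wv e_sym va => /(_ isT).
case/forall_inPn=> a' Aa' ta'.
case: (boolP [forall v in W :\: A, t v == 1%g]) => [/forall_inP tB|].
  apply: (isolated_vertex_char_variety (b := b)) => [|v vb]; first exact/eqP/tB.
  apply/eqP; have [Av|Av] := boolP (v \in A).
    by have := AB v b Av WAb; rewrite vb.
  by have [Wv|/tW ->//] := boolP (v \in W); apply: tB; rewrite inE Av.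
case/forall_inPn=> b' WAb' tb'.
apply/raag_char_variety1P.
exists (fun v => if v \in A then mul_val (t v) - 1 else 0).
  move=> v w vw; case: ifP => Aw; case: ifP => Av //; first by rewrite mulrC.
  - have -> : t v = 1%g.
      apply: tW; apply/negP => Wv.
      by have := AB w v Aw; rewrite inE Av Wv e_sym vw => /(_ isT).
    by rewrite subrr mulr0 mul0r.
  - have -> : t w = 1%g.
      apply: tW; apply/negP => Ww.
      by have := AB v w Av; rewrite inE Aw Ww vw => /(_ isT).
    by rewrite subrr mulr0 mul0r.
  - by rewrite !mulr0.
move=> [c cE]; have := cE a'; rewrite Aa' -[LHS]mulr1.
move/(mulfI (nontrivial_coord ta')) => c1.
have := cE b'; move: WAb'; rewrite inE -c1 mulr1 => /andP[/negPf-> _] /esym/eqP.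
by rewrite (negPf (nontrivial_coord tb')).
Qed.

(** Subtract a coboundary from the solution so that it vanishes at one vertex
    of the support of [t].  The set [W] collects the support of [t] and that of
    the new solution [y]; it splits according to whether [y] vanishes.  An edge
    from [a] with [y a = 0] (hence [t a <> 1]) to [b] with [y b <> 0] would give
    [(t a - 1) y b = 0]. *)
Lemma char_variety_disconnected t : raag_char_variety1 F e t ->
  exists2 W, disconnected_on e W & subtorus F V W t.
Proof.
move=> /raag_char_variety1P[x tx xB].
case: (boolP [forall v, t v == 1%g]) => [/forallP t1|/forallPn[s ts]].
  exists finset.set0; first exact: disconnected_on0.
  by move=> v _; apply/eqP.
pose c := x s / (mul_val (t s) - 1).
pose y v := x v - (mul_val (t v) - 1) * c.
have ys : y s = 0 by rewrite /y /c mulrC divfK ?subrr ?nontrivial_coord.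
have ty : edge_cocycle e t y.
  by move=> v w vw; rewrite /y !mulrBr (tx _ _ vw); ring.
have /existsNP[v /eqP yv] : ~ forall v, y v = 0.
  move=> y0; apply: xB; exists c => v.
  by apply/eqP; rewrite -subr_eq0; apply/eqP/y0.
exists [set u | (t u != 1%g) || (y u != 0)]%SET; last first.
  by move=> u; rewrite inE negb_or negbK => /andP[/eqP].
apply: (separates_disconnected e_sym
  (A := [set u | (t u != 1%g) && (y u == 0)]%SET)).
split.
- by apply/fintype.subsetP => u; rewrite !inE => /andP[->].
- by apply/set0Pn; exists s; rewrite inE ts ys eqxx.
- by apply/set0Pn; exists v; rewrite !inE (negPf yv) andbF orbT.
- move=> a b; rewrite !inE => /andP[ta /eqP ya] /andP[].
  rewrite negb_and negbK => tyb tb.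
  have yb : y b != 0 by move: tyb tb; case: eqP => //=; rewrite orbF.
  apply/negP => /ty/eqP; rewrite ya mulr0 mulf_eq0 (negPf yb) orbF.
  by rewrite (negPf (nontrivial_coord ta)).
Qed.

Lemma raag_char_variety1E :
  raag_char_variety1 F e
    = \bigcup_(W in [set W : {set V} | max_disconnected e W]) subtorus F V W.
Proof.
apply/seteqP; split=> t.
  case/char_variety_disconnected=> W /maxset_exists[W' W'max WW'] tW.
  exists W' => // v W'v; apply: tW; apply: contra W'v; exact: fintype.subsetP.
by move=> [W /maxsetp Wd]; apply: disconnected_char_variety.
Qed.

End CharVariety.

(** * Irreducible components of a union of coordinate subtori *)

Section ZariskiTopology.
Variables (F : fieldType) (V : finType).
Implicit Types (t : torus F V) (W : {set V}).

Lemma zariski_closed0 : zariski_closed (set0 : set (torus F V)).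
Proof.
exists [set 1]; apply/seteqP; split=> t // /(_ 1 erefl)/eqP.
by rewrite meval1 oner_eq0.
Qed.

Lemma zariski_closedU (A B : set (torus F V)) :
  zariski_closed A -> zariski_closed B -> zariski_closed (A `|` B).
Proof.
move=> [S ->] [S' ->].
exists [set r | exists p q, [/\ S p, S' q & r = p * q]].
apply/seteqP; split=> [t [tS|tS] _ [p [q [Sp S'q ->]]]|t tSS].
- by rewrite mevalM tS // mul0r.
- by rewrite mevalM (tS q) // mulr0.
have [|/existsNP[p /not_implyP[Sp /eqP pt]]] := pselect (zero_locus S t).
  by left.
right=> q S'q; have : (p * q).@[fun i => mul_val (t (enum_val i))] = 0.
  by apply: tSS; exists p, q.
by move/eqP; rewrite mevalM mulf_eq0 (negPf pt) => /eqP.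
Qed.

Lemma subtorus_closed W : zariski_closed (subtorus F V W).
Proof.
exists [set p | exists2 v, v \notin W & p = 'X_(enum_rank v) - 1].
apply/seteqP; split=> [t tW _ [v Wv ->]|t tS v Wv].
  by rewrite mevalB mevalXU meval1 enum_rankK tW //= subrr.
have := tS _ (ex_intro2 _ _ v Wv erefl).
rewrite mevalB mevalXU meval1 enum_rankK => /eqP; rewrite subr_eq0 => /eqP tv.
exact: val_inj.
Qed.

(** Irreducibility is about covers by two closed sets; induction extends it to
    finite covers. *)
Lemma irreducible_sub_bigcup (I : choiceType) (r : seq I)
    (T : I -> set (torus F V)) Y :
  (forall i, zariski_closed (T i)) -> zariski_irreducible Y ->
  Y `<=` \bigcup_(i in [set` r]) T i -> exists2 i, i \in r & Y `<=` T i.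
Proof.
move=> Tcl [[y Yy] Ysplit]; rewrite bigcup_seq.
elim: r => [|i r IHr]; first by rewrite big_nil => /(_ y Yy).
have Ucl : zariski_closed (\big[setU/set0]_(j <- r) T j).
  by apply: big_ind => //; [exact: zariski_closed0|exact: zariski_closedU].
rewrite big_cons => /(Ysplit _ _ (Tcl i) Ucl)[YT|/IHr[j jr YT]].
  by exists i; rewrite ?mem_head.
by exists j; rewrite // inE jr orbT.
Qed.

Lemma meval_horner n (q : 'I_n -> {poly F}) (p : {mpoly F[n]}) :
  {P : {poly F} | forall s, P.[s] = p.@[fun i => (q i).[s]]}.
Proof.
exists (\sum_(m <- msupp p) (p@_m)%:P * \prod_(i < n) q i ^+ m i) => s.
rewrite horner_sum mevalE; apply: eq_bigr => m _.
rewrite hornerM hornerC horner_prod; congr (_ * _).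
by apply: eq_bigr => i _; rewrite horner_exp.
Qed.

(** Over a finite field the torus is a finite set of points, and a subtorus
    with more than one point is reducible. *)
Hypothesis F_infinite : forall r : seq F, exists s, s \notin r.

Lemma poly_nonroot (P : {poly F}) : P != 0 -> exists s, ~~ root P s.
Proof.
move=> P0; apply: contrapT => /forallNP Proots.
have [r [r_uniq rP]] : exists r : seq F, uniq r /\ size r = size P.
  elim: (size P) => [|k [r [r_uniq <-]]]; first by exists [::].
  by have [s sr] := F_infinite r; exists (s :: r); rewrite /= sr.
have r_roots : all (root P) r by apply/allP => s _; apply/negPn/negP/Proots.
by have := max_poly_roots P0 r_roots r_uniq; rewrite rP ltnn.
Qed.

(** The equations [t v = 1] that cut out the subtorus are affine, so the line
    through two of its points satisfies them; the line leaves the torus only at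
    the finitely many parameters where some coordinate vanishes. *)
Lemma subtorus_irreducible W : zariski_irreducible (subtorus F V W).
Proof.
split; first by exists [ffun=> 1%g] => v _; rewrite ffunE.
move=> _ _ [S ->] [S' ->] WSS.
apply: contrapT => /not_orP[].
move=> /existsNP[t /not_implyP[tW /existsNP[p /not_implyP[Sp /eqP pt]]]].
move=> /existsNP[t' /not_implyP[t'W /existsNP[p' /not_implyP[Sp' /eqP pt']]]].
(* The line from t, at parameter 0, to t', at parameter 1. *)
pose q v := (mul_val (t v))%:P + (mul_val (t' v) - mul_val (t v)) *: 'X.
have q0 v : (q v).[0] = mul_val (t v).
  by rewrite hornerD hornerC hornerZ hornerX mulr0 addr0.
have q1 v : (q v).[1] = mul_val (t' v).
  by rewrite hornerD hornerC hornerZ hornerX mulr1 addrC subrK.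
have [P PE] := meval_horner (fun i => q (enum_val i)) p.
have [P' P'E] := meval_horner (fun i => q (enum_val i)) p'.
have P0 : P != 0.
  apply: contraNneq pt => P0; have := PE 0; rewrite P0 horner0 => ->.
  by apply/eqP/meval_eq => i; rewrite q0.
have P'0 : P' != 0.
  apply: contraNneq pt' => P'0; have := P'E 1; rewrite P'0 horner0 => ->.
  by apply/eqP/meval_eq => i; rewrite q1.
have Q0 : \prod_v q v != 0.
  apply/prodf_neq0 => v _; apply/eqP => qv0.
  by have := mul_valP (t v); rewrite -q0 qv0 horner0 eqxx.
have [s] := poly_nonroot (mulf_neq0 (mulf_neq0 P0 P'0) Q0).
rewrite !rootM !negb_or => /andP[/andP[Ps P's]].
rewrite /root horner_prod => /prodf_neq0 qs.
pose u : torus F V := [ffun v => MulGroup (qs v isT)].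
have uE i : mul_val (u (enum_val i)) = (q (enum_val i)).[s] by rewrite ffunE.
have uW : subtorus F V W u.
  move=> v Wv; apply: val_inj; rewrite ffunE /= /q tW // t'W //.
  by rewrite !hornerE subrr mul0r addr0.
have [uS|uS'] := WSS u uW.
  by case/negP: Ps; rewrite /root PE -(uS p Sp); apply/eqP/meval_eq.
by case/negP: P's; rewrite /root P'E -(uS' p' Sp'); apply/eqP/meval_eq.
Qed.

Lemma subtorus_subset W W' :
  subtorus F V W `<=` subtorus F V W' -> W \subset W'.
Proof.
move=> WW'; apply/fintype.subsetP => v Wv; apply/negPn/negP => W'v.
have [z] := F_infinite [:: 0; 1]; rewrite !inE negb_or => /andP[z0 z1].
pose t : torus F V := [ffun w => if w == v then MulGroup z0 else 1%g].
have tW : subtorus F V W t.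
  by move=> w Ww; rewrite ffunE ifN //; apply: contraNneq Ww => ->.
have := congr1 val (WW' t tW v W'v); rewrite ffunE eqxx /= => z1'.
by rewrite z1' eqxx in z1.
Qed.

(** An irreducible subset of a finite union of closed sets lies in one of them,
    so the maximal irreducible subsets are among the subtori; as none of the
    subtori contains another, all of them are maximal. *)
Lemma irreducible_component_subtori (D : pred {set V}) :
  {in D &, forall W W', W \subset W' -> W = W'} ->
  [set Z | irreducible_component
             (\bigcup_(W in [set W | D W]) subtorus F V W) Z]
    = [set subtorus F V W | W in [set W | D W]].
Proof.
move=> Dmax; set X := (\bigcup_(W in _) _).
have subX W : D W -> subtorus F V W `<=` X by move=> DW; apply: bigcup_sup.
have irrX Y : Y `<=` X -> zariski_irreducible Y ->
    exists2 W, D W & Y `<=` subtorus F V W.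
  move=> YX Yirr.
  have [||W] := @irreducible_sub_bigcup _ (enum D) (subtorus F V) Y _ Yirr.
  - exact: subtorus_closed.
  - by move=> t /YX[W DW tW]; exists W => //=; rewrite mem_enum.
  - by rewrite mem_enum => DW YW; exists W.
apply/seteqP; split=> [Z [ZX Zirr Zmax]|_ [W DW <-]].
  have [W DW ZW] := irrX Z ZX Zirr.
  exists W => //; apply: Zmax => //; first exact: subX.
  exact: subtorus_irreducible.
split; [exact: subX|exact: subtorus_irreducible|move=> Y YX Yirr WY].
have [W' DW' YW'] := irrX Y YX Yirr.
have WW' : W = W' by apply: Dmax => //; apply/subtorus_subset/(subset_trans WY).
by apply/seteqP; split=> //; rewrite WW'.
Qed.

End ZariskiTopology.

Lemma num_infinite (F : numFieldType) (r : seq F) : exists s, s \notin r.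
Proof.
apply: contrapT => /forallNP r_all.
pose N := [seq k%:R : F | k <- iota 0 (size r).+1].
have N_uniq : uniq N.
  rewrite map_inj_uniq ?iota_uniq //.
  exact: (Num.Theory.mulrIn (oner_neq0 F)).
have : (size N <= size r)%N.
  by apply: uniq_leq_size => // s _; apply/negPn/negP/r_all.
by rewrite size_map size_iota ltnn.
Qed.

Theorem proposition11p5 (R : realType) (V : finType) (e : rel V)
    (V_nonempty : (0 < #|V|)%N)
    (e_sym : symmetric e) (e_irr : irreflexive e) :
  raag_char_variety1 R[i] e
    = \bigcup_(W in [set W : {set V} | max_disconnected e W])
        subtorus R[i] V W
  /\
  [set Z | irreducible_component (raag_char_variety1 R[i] e) Z]
    = [set subtorus R[i] V W | W in [set W : {set V} | max_disconnected e W]].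
Proof.
have V1E := raag_char_variety1E R[i] V_nonempty e_sym.
split=> //; rewrite V1E.
apply: irreducible_component_subtori.
  exact: num_infinite.
by move=> W W' /maxsetP[_ Wmax] /maxsetp W'd /Wmax ->.
Qed.
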